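(* For every class $\mathcal H$, $\mathtt{sd}(\mathcal H)+1\le\mathtt{SCO}(\mathcal H)$.
   Context: A class $\mathcal H$ over a domain $X$ is a nonempty set of functions $X\to\{-,+\}$. For a distribution $\mu$ on $X\times\{-,+\}$, $L_\mu(h)=\Pr_{(x,y)\sim\mu}[h(x)\ne y]$; $\mu$ is realizable if $\inf_{h\in\mathcal H}L_\mu(h)=0$, and $\Delta(\mathcal H)$ is the set of realizable distributions. A $d$-dimensional stochastic convex optimization (SCO) problem is given by a set $Z$, a convex set $W\subseteq\mathbb R^d$ and convex functions $\ell_z:W\to\mathbb R_{\ge0}$, $z\in Z$; for a distribution $\zeta$ on $Z$, $L_\zeta(w)=\mathbb E_{z\sim\zeta}\ell_z(w)$. For $\alpha>0$, $\beta\ge0$, an $(\alpha,\beta)$-reduction from $\mathcal H$ to $(Z,W)$ consists of maps $r_{\mathrm{in}}:X\times\{-,+\}\to Z$ and $r_{\mathrm{out}}:W\to\{-,+\}^X$ such that for every $\mu\in\Delta(\mathcal H)$ and $w\in W$: if $L_{r_{\mathrm{in}}(\mu)}(w)\le\inf_{w'\in W}L_{r_{\mathrm{in}}(\mu)}(w')+\alpha$ then $L_\mu(r_{\mathrm{out}}(w))\le\beta$, where $r_{\mathrm{in}}(\mu)$ is the push-forward of $\mu$. $\mathtt{SCO}(\mathcal H)$ is the smallest $d$ for which there is an $(\alpha,\beta)$-reduction from $\mathcal H$ to some $d$-dimensional SCO problem with some $\alpha>0$ and $0<\beta<1/2$. $\mathtt{sd}(\mathcal H)$: for finite $X'\subseteq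 X$, $\Delta(\mathcal H|_{X'})$ is the simplicial complex on vertices $X'\times\{-,+\}$ (space of distributions realizable by $\mathcal H|_{X'}$) whose simplices are the sets $F$ with some $h\in\mathcal H$ having $h(x)=y$ on $F$; $(-\mu)(x,y)=\mu(x,-y)$; $\Delta^{\mathrm{ant}}$ is the subcomplex of $F$ with $\{(x,-y):(x,y)\in F\}$ also a simplex. $\mathtt{sd}(\mathcal H)$ is the largest $n$ such that for some finite $X'$ there is a continuous $f:\mathbb S^n\to\|\Delta^{\mathrm{ant}}(\mathcal H|_{X'})\|$ with $f(-v)=-f(v)$ ($-1$ if none). *)

(* Defs.v *)
From HB Require Import structures.
From mathcomp Require Import all_boot all_order all_algebra finmap.
From mathcomp Require Import all_classical all_reals all_analysis.
Set Implicit Arguments.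
Unset Strict Implicit.
Unset Printing Implicit Defensive.
Import Order.TTheory GRing.Theory Num.Theory.
Import numFieldNormedType.Exports.
Local Open Scope classical_set_scope.
Local Open Scope ring_scope.

(* The labels {-,+} are the booleans, with [true] for +; negation of a label
   is [~~]. *)

Definition flip {T : Type} (q : T * bool) : T * bool := (q.1, ~~ q.2).

(* Distributions are probability measures for an arbitrary sigma-algebra on X
   (and on Z), and every map that enters a probability or an expectation is
   required to be measurable. Nothing is lost for arbitrary classes and maps:
   with the discrete sigma-algebras, where all sets are measurable, these
   requirements hold trivially. The library's measurable types are inhabited,
   so the domain X is nonempty. *)

Definition class_of d (X : measurableType d) (H : set (X -> bool)) : Prop :=
  H !=set0 /\ forall h, H h -> measurable_fun setT h.

Definition class_loss d (X : measurableType d) (R : realType)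
    (mu : probability (X * bool)%type R) (h : X -> bool) : \bar R :=
  mu [set q | h q.1 != q.2].

Definition realizable d (X : measurableType d) (R : realType)
    (H : set (X -> bool)) (mu : probability (X * bool)%type R) : Prop :=
  ereal_inf [set class_loss mu h | h in H] = 0%E.

(* The losses are total functions on R^n, constrained only on W. The set W is
   nonempty: over an empty W every pair of maps would be a reduction. *)
Record sco_problem (R : realType) (n : nat) dZ (Z : measurableType dZ) :=
  ScoProblem {
    sco_dom : set 'rV[R]_n ;
    sco_loss : Z -> 'rV[R]_n -> R ;
    sco_dom_nonempty : sco_dom !=set0 ;
    sco_dom_convex : convex_set sco_dom ;
    sco_loss_ge0 : forall z w, sco_dom w -> 0 <= sco_loss z w ;
    sco_loss_convex : forall z, convex_function sco_dom (sco_loss z) ;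
    sco_loss_measurable : forall w, sco_dom w ->
      measurable_fun setT (fun z => sco_loss z w) }.

Definition sco_risk (R : realType) (n : nat) dZ (Z : measurableType dZ)
    (P : sco_problem R n Z) (zeta : set Z -> \bar R) (w : 'rV[R]_n) : \bar R :=
  (\int[zeta]_z (sco_loss P z w)%:E)%E.

Definition is_reduction d (X : measurableType d) (R : realType)
    (H : set (X -> bool)) (n : nat) dZ (Z : measurableType dZ)
    (P : sco_problem R n Z) (alpha beta : R)
    (rin : X * bool -> Z) (rout : 'rV[R]_n -> X -> bool) : Prop :=
  [/\ measurable_fun setT rin,
      forall w, sco_dom P w -> measurable_fun setT (rout w) &
      forall mu : probability (X * bool)%type R, realizable H mu ->
        forall w, sco_dom P w ->
        (sco_risk P (pushforward mu rin) w <=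
           ereal_inf [set sco_risk P (pushforward mu rin) w'
                     | w' in sco_dom P] + alpha%:E)%E ->
        (class_loss mu (rout w) <= beta%:E)%E].

Definition sco_reducible d (X : measurableType d) (R : realType)
    (H : set (X -> bool)) (n : nat) : Prop :=
  exists (dZ : measure_display) (Z : measurableType dZ)
    (P : sco_problem R n Z) (alpha beta : R)
    (rin : X * bool -> Z) (rout : 'rV[R]_n -> X -> bool),
    [/\ 0 < alpha, 0 < beta < 2^-1 & is_reduction H P alpha beta rin rout].

(* The least such dimension, and +oo if there is none. *)
Definition SCO d (X : measurableType d) (R : realType)
    (H : set (X -> bool)) : \bar R :=
  ereal_inf [set (n%:R : R)%:E | n in [set n | sco_reducible R H n]].

Definition restrict_class (X : choiceType) (H : set (X -> bool))
    (X' : {fset X}) : set (X' -> bool) :=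
  [set (fun x : X' => h (val x)) | h in H].

(* T is finite below, so that all simplices are finite. *)
Definition realizable_complex (T : Type) (K : set (T -> bool)) :
    set (set (T * bool)) :=
  [set F | exists2 h, K h & forall q, F q -> h q.1 = q.2].

Definition antipodal_complex (T : Type) (K : set (T -> bool)) :
    set (set (T * bool)) :=
  [set F | realizable_complex K F /\ realizable_complex K (flip @` F)].

(* Barycentric coordinates; since V is finite, the pointwise topology on
   functions V -> R is the Euclidean one. *)
Definition geometric_realization (R : realType) (V : finType)
    (C : set (set V)) : set {ptws V -> R} :=
  [set p | [/\ forall v, 0 <= p v, \sum_v p v = 1 & C [set v | p v != 0]]].

(* The Euclidean unit sphere S^n of R^(n+1); the library norm on row vectors is
   the sup norm. *)
Definition unit_sphere (R : realType) (n : nat) : set 'rV[R]_n.+1 :=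
  [set v | \sum_i v 0 i ^+ 2 = 1].
Arguments unit_sphere R n : clear implicits.

Definition antipodal_sphere_map (R : realType) (X : choiceType)
    (H : set (X -> bool)) (n : nat) : Prop :=
  exists (X' : {fset X})
    (f : 'rV[R]_n.+1 -> {ptws (X' * bool)%type -> R}),
    [/\ {within unit_sphere R n, continuous f},
        forall v, unit_sphere R n v ->
          geometric_realization (antipodal_complex (restrict_class H (X' := X')))
             (f v) &
        forall v, unit_sphere R n v -> f (- v) = f v \o flip].

(* The value is -1 if there is no such n, and +oo if they are unbounded. *)
Definition sd (R : realType) (X : choiceType) (H : set (X -> bool)) : \bar R :=
  ereal_sup ([set (-1)%:E] `|`
             [set (n%:R : R)%:E | n in [set n | antipodal_sphere_map R H n]]).

(* Main.v *)
From HB Require Import structures.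
Require Import Defs.
From mathcomp Require Import all_boot all_order all_algebra finmap.
From mathcomp Require Import all_classical all_reals all_analysis.
From mathcomp Require Import measurable_realfun lra ring.
Set Implicit Arguments.
Unset Strict Implicit.
Unset Printing Implicit Defensive.
Import Order.TTheory GRing.Theory Num.Theory.
Import numFieldNormedType.Exports.
Local Open Scope classical_set_scope.
Local Open Scope ring_scope.

(* Let f be an antipodal map from S^n to distributions p such that both p and
   its label-flip are realizable. The infimal risk is lower semicontinuous in
   p, so a near-minimizer for f(u) stays one for f(u') with u' near u. Sets of
   near-minimizers are convex, and a partition of unity yields a continuous
   w : S^n -> R^m such that w(u) is a near-minimizer for f(u). If m <= n, then
   Borsuk-Ulam gives w(u) = w(-u), so a single output hypothesis has loss at
   most beta < 1/2 on f(u) and on its flip; but these two losses add up to 1.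

   Borsuk-Ulam is proved with cochains mod 2. For antipodal 2-colourings s_i of
   the vertices, the cup product of the coboundaries of s_0, ..., s_(n-1) is 1
   on a hemisphere of every subdivision of the boundary of the cross-polytope.
   Hence some n-simplex of every subdivision is monochromatic for no s_i. If an
   odd map to R^m, m <= n, had no zero, then, with s_i the sign of its i-th
   coordinate, every sufficiently small simplex would be monochromatic for
   some s_i. *)

(** * Cochains and subdivisions *)

Section Cochains.
Context {V : eqType}.
Implicit Types (phi psi : seq V -> bool) (s t : seq V).

(* A simplex is the list of its vertices, a cochain mod 2 any function of such
   lists; the complex is augmented, the empty list being a face of a vertex. *)
Fixpoint coboundary phi s : bool :=
  if s is x :: t then phi t (+) coboundary (phi \o cons x) t else false.

Definition cochain_add phi psi s := phi s (+) psi s.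

Lemma coboundaryD phi psi :
  coboundary (cochain_add phi psi) = cochain_add (coboundary phi) (coboundary psi).
Proof.
apply/funext => s; elim: s phi psi => //= x s IH phi psi.
rewrite [_ \o _](_ : _ = cochain_add (phi \o cons x) (psi \o cons x)) // IH.
by rewrite /cochain_add /= addbACA.
Qed.

(** A coboundary at [s] sees only the faces of [s], so identities between cochains need only be
    checked in one dimension and on vertices in [C]. *)
Lemma eq_coboundary (C : V -> Prop) k phi psi s :
  (forall t, size t = k -> ({in t, forall v, C v}) -> phi t = psi t) ->
  size s = k.+1 -> ({in s, forall v, C v}) ->
  coboundary phi s = coboundary psi s.
Proof.
elim: s k phi psi => //= x s IH k phi psi E [Es] Cs.
have Cs' : {in s, forall v, C v} by move=> v vs; apply: Cs; rewrite inE vs orbT.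
rewrite E //; congr (_ (+) _).
case: k Es E => [|k] Es E; first by case: s Es {IH Cs Cs'}.
apply: (IH k) => // t Et Ct; apply: E => [/=|v]; first by rewrite Et.
by rewrite inE => /predU1P[->|/Ct//]; apply: Cs; rewrite mem_head.
Qed.

Lemma coboundaryK phi s : coboundary (coboundary phi) s = false.
Proof.
elim: s phi => //= x s IH phi.
rewrite [_ \o _](_ : _ = cochain_add phi (coboundary (phi \o cons x))) //.
by rewrite coboundaryD /cochain_add IH addbF addbb.
Qed.

Lemma coboundary_false s : coboundary (fun=> false) s = false.
Proof. by elim: s => //= x s; rewrite [_ \o _](_ : _ = fun=> false). Qed.

Lemma coboundary_andl (b : bool) phi s :
  coboundary (fun t => b && phi t) s = b && coboundary phi s.
Proof.
case: b => //=; exact: coboundary_false.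
Qed.

(* The cup product of the coboundaries of the 0-cochains fs. *)
Fixpoint cup_coboundary (fs : seq (V -> bool)) s : bool :=
  if fs is f :: gs then
    if s is v :: t then
      (f v (+) f (head v t)) && cup_coboundary gs t
    else false
  else true.

(** The cup product of the 0-cochain [f] itself with the coboundaries of [fs]: a primitive of the
    product with one more factor. *)
Definition cup_head (f : V -> bool) (fs : seq (V -> bool)) s : bool :=
  (if s is v :: _ then f v else false) && cup_coboundary fs s.

(** The Leibniz rule: a product of coboundaries is a cocycle, so only the coboundary of [f]
    contributes. *)
Lemma coboundary_cup_head f fs s : size s = (size fs).+2 ->
  coboundary (cup_head f fs) s = cup_coboundary (f :: fs) s.
Proof.
move: s f; elim: fs => [|g fs IH] [//|v0 [//|v1 s]] f /= [].
  by move=> /size0nil ->; rewrite /cup_head /= !andbT addbF addbC.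
move=> Es.
(* By induction this product is itself a coboundary, hence closed. *)
have cl : coboundary (cup_coboundary (g :: fs)) [:: v0, v1 & s] = false.
  rewrite -(coboundaryK (cup_head g fs) [:: v0, v1 & s]).
  apply: (@eq_coboundary (fun=> True) (size fs).+2) => //=; last by rewrite Es.
  by move=> t Et _; rewrite IH.
(* Closedness again, with the face opposite to [v0] split off. *)
have cup : coboundary (fun t => cup_coboundary (g :: fs) (v0 :: t)) (v1 :: s) =
   cup_coboundary (g :: fs) (v1 :: s).
  by apply/esym/eqP; rewrite -negb_add; apply/negbT; exact: cl.
rewrite -[LHS]/(cup_head f (g :: fs) (v1 :: s) (+)
  coboundary (fun t => f v0 && cup_coboundary (g :: fs) (v0 :: t)) (v1 :: s)).
rewrite coboundary_andl cup /cup_head.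
by rewrite -andb_addl addbC.
Qed.

(** Each factor is evaluated on an edge of [s], so a nonzero product rules out that [s] is
    monochromatic for any factor. *)
Lemma cup_coboundary_neq fs s : size s = (size fs).+1 -> cup_coboundary fs s ->
  {in fs, forall f, exists u v, [/\ u \in s, v \in s & f u != f v]}.
Proof.
elim: fs s => // f fs IH [//|v0 [//|v1 s]] [Es].
rewrite -[cup_coboundary _ _]/((f v0 (+) f v1) && cup_coboundary fs (v1 :: s)).
move=> /andP[f01 /(IH (v1 :: s) (congr1 S Es)) {}IH] g.
rewrite inE => /predU1P[->|/IH[u [v [us vs uv]]]].
  exists v0, v1; rewrite !inE !eqxx orbT; split=> //.
  by case: (f v0) f01 => /=; case: (f v1).
by exists u, v; rewrite ![_ \in v0 :: _]inE us vs !orbT.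
Qed.

Section Negation.
Variable T : V -> V.

Lemma coboundary_map phi s :
  coboundary phi (map T s) = coboundary (phi \o map T) s.
Proof. by elim: s phi => //= x s IH phi; rewrite IH. Qed.

Lemma cup_coboundary_map fs s : size s = (size fs).+1 ->
  {in fs, forall f, {in s, forall v, f (T v) = ~~ f v}} ->
  cup_coboundary fs (map T s) = cup_coboundary fs s.
Proof.
elim: fs s => // f fs IH [//|v0 [//|v1 s]] Es E.
rewrite -[LHS]/((f (T v0) (+) f (T v1)) && cup_coboundary fs (map T (v1 :: s))).
rewrite !E ?inE ?eqxx ?orbT// IH; first by rewrite addbN addNb negbK.
- by case: Es => <-.
- move=> g gfs v vs; apply: E; first by rewrite inE gfs orbT.
  by rewrite inE vs orbT.
Qed.

(** Negating both ends of an edge preserves their difference, so the product is [T]-invariant, while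
    the leading values [f v] and [~~ f v] add up to 1. This removes one factor in the hemisphere
    induction. *)
Lemma cup_head_map f fs s : size s = (size fs).+1 ->
  {in f :: fs, forall f, {in s, forall v, f (T v) = ~~ f v}} ->
  cochain_add (cup_head f fs) (cup_head f fs \o map T) s = cup_coboundary fs s.
Proof.
case: s => // v s Es E; rewrite /cochain_add /cup_head.
rewrite [(_ \o _) _]/= -map_cons cup_coboundary_map //; last first.
  by move=> g gfs w ws; apply: E => //; rewrite inE gfs orbT.
rewrite E ?mem_head//.
by case: (f v) => //=; rewrite ?addbF.
Qed.

End Negation.

End Cochains.

(** * Barycentric subdivision and the hemispheres of the cross-polytope *)

Section Subdivision.
Context {R : realType} {V : normedModType R}.
Implicit Types (phi psi : seq V -> bool) (s t : seq V).

Definition barycenter s : V := (size s)%:R^-1 *: \sum_(v <- s) v.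

Lemma barycenterN s : barycenter (map -%R s) = - barycenter s.
Proof. by rewrite /barycenter size_map big_map sumrN scalerN. Qed.

Lemma barycenterB s v : s != [::] ->
  barycenter s - v = (size s)%:R^-1 *: \sum_(u <- s) (u - v).
Proof.
move=> s0; rewrite sumrB scalerBr; congr (_ - _).
rewrite big_const_seq count_predT iter_addr_0 -[v *+ _]scaler_nat scalerA.
rewrite mulVf ?scale1r//.
by rewrite pnatr_eq0 size_eq0.
Qed.

Definition barycenter_closed (C : set V) :=
  forall s, s != [::] -> {in s, forall v, C v} -> C (barycenter s).

Lemma barycenter_closedI C C' : barycenter_closed C -> barycenter_closed C' ->
  barycenter_closed (C `&` C').
Proof. by move=> B B' s s0 h; split; [apply: B|apply: B'] => // v /h[]. Qed.

Lemma barycenter_closed_ball b (r : R) :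
  barycenter_closed [set v | `|v - b| <= r].
Proof.
move=> s s0 h /=; rewrite barycenterB// normrZ normfV ger0_norm//.
rewrite ler_pdivrMl ?ltr0n ?lt0n ?size_eq0// (le_trans (ler_norm_sum _ _ _))//.
rewrite mulrC mulr_natr -iter_addr_0 -count_predT -big_const_seq.
by rewrite big_seq [leRHS]big_seq; apply: ler_sum => v vs; exact: h.
Qed.

(** In the average of the differences to [v], the term of [v] itself vanishes, leaving [size s - 1]
    terms out of [size s]. *)
Lemma barycenter_dist s v D N : v \in s -> (size s <= N)%N ->
  {in s &, forall u w, `|u - w| <= D} -> `|v - barycenter s| <= (1 - N%:R^-1) * D.
Proof.
move=> vs sN h.
have s0 : s != [::] by apply: contraTneq vs => ->.
have D0 : 0 <= D by rewrite (le_trans _ (h v v vs vs)).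
rewrite distrC barycenterB// normrZ normfV ger0_norm//.
apply: (@le_trans _ _ ((1 - (size s)%:R^-1) * D)); last first.
  apply: ler_wpM2r => //; rewrite lerD2l lerN2 lef_pV2 ?posrE ?ler_nat//.
    by rewrite ltr0n (leq_trans _ sN)// lt0n size_eq0.
  by rewrite ltr0n lt0n size_eq0.
have sz : 0 < (size s)%:R :> R by rewrite ltr0n lt0n size_eq0.
rewrite ler_pdivrMl// (le_trans (ler_norm_sum _ _ _))//.
rewrite mulrA mulrBr mulr1 mulfV ?gt_eqF// (perm_big _ (perm_to_rem vs)) big_cons.
rewrite -[leLHS]/(`|v - v| + \sum_(u <- rem v s) `|u - v|).
rewrite subrr normr0 add0r (perm_size (perm_to_rem vs)) /= -natr1 addrK.
rewrite mulr_natl -iter_addr_0 -count_predT -big_const_seq.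
rewrite big_seq [leRHS]big_seq; apply: ler_sum => u us.
by apply: h => //; rewrite (mem_rem us).
Qed.

(* Evaluates [phi] on the barycentric subdivision of [s], in dimension [k]. *)
Fixpoint subdivide_dim k phi s : bool :=
  if k is k'.+1 then coboundary (subdivide_dim k' (phi \o cons (barycenter s))) s
  else phi s.

Definition subdivide phi s := subdivide_dim (size s) phi s.

Lemma subdivide_dimD k phi psi s : subdivide_dim k (cochain_add phi psi) s =
  subdivide_dim k phi s (+) subdivide_dim k psi s.
Proof.
elim: k phi psi s => //= k IH phi psi s.
rewrite -[RHS]/(cochain_add (coboundary _) (coboundary _) s) -coboundaryD.
by congr coboundary; apply/funext => t; rewrite /cochain_add -IH.
Qed.

Lemma subdivideD phi psi :
  subdivide (cochain_add phi psi) = cochain_add (subdivide phi) (subdivide psi).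
Proof. by apply/funext => s; exact: subdivide_dimD. Qed.

Lemma iter_subdivideD m phi psi : iter m subdivide (cochain_add phi psi) =
  cochain_add (iter m subdivide phi) (iter m subdivide psi).
Proof. by elim: m => //= m ->; rewrite subdivideD. Qed.

Lemma subdivide_dimN k phi s :
  subdivide_dim k phi (map -%R s) = subdivide_dim k (phi \o map -%R) s.
Proof.
elim: k phi s => //= k IH phi s; rewrite coboundary_map barycenterN.
by congr coboundary; apply/funext => t; rewrite /= IH.
Qed.

Lemma iter_subdivideN m phi :
  iter m subdivide phi \o map -%R = iter m subdivide (phi \o map -%R).
Proof.
elim: m => //= m <-; apply/funext => s.
by rewrite /subdivide /= size_map subdivide_dimN.
Qed.

(** Subdivision is a chain map: the coboundary of [phi] on a cone with apex [b] is [phi] on the base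
    plus a term that becomes, by induction, a double coboundary. *)
Lemma subdivide_dim_coboundary k phi s : size s = k ->
  subdivide_dim k (coboundary phi) s = coboundary (subdivide_dim k.-1 phi) s.
Proof.
elim: k phi s => [|k IH] phi s Es /=; first by rewrite (size0nil Es).
set b := barycenter s.
have -> : subdivide_dim k (coboundary phi \o cons b) =
   cochain_add (subdivide_dim k phi) (subdivide_dim k (coboundary (phi \o cons b))).
  by apply/funext => t; rewrite /cochain_add -subdivide_dimD.
rewrite coboundaryD /cochain_add.
rewrite -[RHS]addbF -(coboundaryK (subdivide_dim k.-1 (phi \o cons b)) s).
congr (_ (+) _); apply: (@eq_coboundary _ (fun=> True) k) => // t Et _.
exact: IH.
Qed.

Lemma subdivide_coboundary phi :
  subdivide (coboundary phi) = coboundary (subdivide phi).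
Proof.
apply/funext => s; rewrite /subdivide subdivide_dim_coboundary//.
case: s => // v s; apply: (@eq_coboundary _ (fun=> True) (size s)) => //.
by move=> t Et _; rewrite Et.
Qed.

Lemma iter_subdivide_coboundary m phi :
  iter m subdivide (coboundary phi) = coboundary (iter m subdivide phi).
Proof. by elim: m => //= m ->; rewrite subdivide_coboundary. Qed.

Definition fine_simplex (C : set V) (D : R) s :=
  {in s, forall v, C v} /\ {in s &, forall u v, `|u - v| <= D}.

(** Subdivision stays in [C] and contracts diameters. Since [N] bounds all dimensions, one ratio
    serves the whole induction and all iterations. *)
Lemma eq_subdivide_dim N k C D phi psi s : (k <= N)%N -> barycenter_closed C ->
  (forall t, size t = k -> fine_simplex C ((1 - N%:R^-1) * D) t -> phi t = psi t) ->
  size s = k -> fine_simplex C D s -> subdivide_dim k phi s = subdivide_dim k psi s.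
Proof.
elim: k C phi psi s => [|k IH] C phi psi s kN BC E Es [Cs Ds] /=.
  by apply: E; rewrite (size0nil Es).
set b := barycenter s; set r := (1 - N%:R^-1) * D.
have s0 : s != [::] by rewrite -size_eq0 Es.
apply: (@eq_coboundary _ (fun v => v \in s) k) => // t Et ts.
(* The ball around [b] contains the vertices of the faces, hence their subdivisions; adding the apex
   [b] then keeps the diameter at most [r]. *)
apply: (IH (C `&` [set v | `|v - b| <= r])) => //; first exact: ltnW.
- by apply: barycenter_closedI => //; exact: barycenter_closed_ball.
- move=> {ts}t {}Et [Ct Dt] /=; apply: E => /=; first by rewrite Et.
  split=> [v|u v]; first by rewrite inE => /predU1P[->|/Ct[]//]; exact: BC.
  have r0 : 0 <= r.
    case: s s0 Es Cs Ds @b t Et Ct Dt => // x s _ Es Cs Ds b t _ _ _.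
    apply: le_trans (normr_ge0 (x - b)) _.
    by apply: barycenter_dist => //; rewrite ?mem_head ?Es.
  rewrite !inE => /predU1P[->|ut] /predU1P[->|vt]; rewrite ?subrr ?normr0 //.
  + by rewrite distrC; case: (Ct _ vt).
  + by case: (Ct _ ut).
  + exact: Dt.
- split=> [v /ts vs|u v /ts us /ts vs]; last exact: Ds.
  by split; [exact: Cs|apply: barycenter_dist => //; rewrite Es].
Qed.

Lemma eq_iter_subdivide N k m C D phi psi s : (k <= N)%N -> barycenter_closed C ->
  (forall t, size t = k -> fine_simplex C ((1 - N%:R^-1) ^+ m * D) t ->
     phi t = psi t) ->
  size s = k -> fine_simplex C D s -> iter m subdivide phi s = iter m subdivide psi s.
Proof.
move=> kN BC; elim: m D s => [|m IH] D s E Es Fs /=.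
  by apply: E => //; rewrite expr0 mul1r.
rewrite /subdivide Es; apply: (@eq_subdivide_dim N k C D) => // t Et Ft.
apply: (IH _ _ _ Et Ft) => u Eu; rewrite mulrA -exprSr => Fu; exact: E.
Qed.

Variable e : nat -> V.

(* Evaluates [phi] on the hemisphere [c k] of the boundary of the cross-polytope
   with vertices [e i] and [- e i]: [c k.+1] is the cone from [e k.+1] over the
   sphere [c k + (- c k)]. *)
Fixpoint hemisphere k phi : bool :=
  if k is k'.+1 then
    hemisphere k' (phi \o cons (e k)) (+)
    hemisphere k' (phi \o cons (e k) \o map -%R)
  else phi [:: e 0].

Lemma hemisphereD k phi psi :
  hemisphere k (cochain_add phi psi) = hemisphere k phi (+) hemisphere k psi.
Proof.
elim: k phi psi => //= k IH phi psi.
by rewrite addbACA -!IH.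
Qed.

(** The boundary of a cone is its base plus the cone over the boundary of the base; here the base is
    a sphere, and the terms of its boundary cancel in pairs. *)
Lemma hemisphere_coboundary k phi : hemisphere k.+1 (coboundary phi) =
  hemisphere k phi (+) hemisphere k (phi \o map -%R).
Proof.
elim: k phi => [|k IH] phi; first by rewrite /= !addbF addbACA addbb addbF.
set psi := phi \o cons (e k.+2).
rewrite -[LHS]/(hemisphere k.+1 (cochain_add phi (coboundary psi)) (+)
  hemisphere k.+1 (cochain_add (phi \o map -%R) (coboundary psi \o map -%R))).
have -> : coboundary psi \o map -%R = coboundary (psi \o map -%R).
  by apply/funext => s; exact: coboundary_map.
rewrite 2!hemisphereD addbACA -[RHS]addbF; congr (_ (+) _).
rewrite !IH (_ : (psi \o map -%R) \o map -%R = psi).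
  by do 2 case: (hemisphere _ _).
by apply/funext => s; rewrite /= -map_comp map_id_in// => v _; rewrite /= opprK.
Qed.

(** No simplex of the hemisphere contains both [e j] and [- e j], so it lies in the facet given by a
    sign pattern [a]. *)
Lemma eq_hemisphere k phi psi :
  (forall s, size s = k.+1 -> (exists a : nat -> bool,
     {in s, forall v, exists2 j, (j <= k)%N & v = (-1) ^+ a j *: e j}) ->
     phi s = psi s) ->
  hemisphere k phi = hemisphere k psi.
Proof.
elim: k phi psi => [|k IH] phi psi E /=.
  apply: E => //; exists (fun=> false) => v; rewrite inE => /eqP ->.
  by exists 0; rewrite ?expr0 ?scale1r.
congr (_ (+) _); apply: IH => s Es [a Ha]; apply: E; rewrite /= ?size_map ?Es//.
  (* The apex [e k.+1] always occurs with sign +; only the base is negated. *)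
  exists (fun j => if j == k.+1 then false else a j) => v.
  rewrite inE => /predU1P[->|/Ha[j jk ->]].
    by exists k.+1; rewrite // eqxx expr0 scale1r.
  by exists j; [exact: leqW|rewrite ltn_eqF].
exists (fun j => if j == k.+1 then false else ~~ a j) => v.
rewrite inE => /predU1P[->|/mapP[w /Ha[j jk ->] ->]].
  by exists k.+1; rewrite // eqxx expr0 scale1r.
by exists j; [exact: leqW|rewrite ltn_eqF// signrN scaleNr].
Qed.

Section FineSimplex.
Variables (n m : nat) (D : R) (C : (nat -> bool) -> set V).
Hypothesis C_closed : forall a, barycenter_closed (C a).
Hypothesis C_vertex : forall a j, (j <= n)%N -> C a ((-1) ^+ a j *: e j).
Hypothesis C_diam : forall a, {in C a &, forall u v, `|u - v| <= D}.

Lemma eq_hemisphere_subdivide k phi psi : (k <= n)%N ->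
  (forall a t, size t = k.+1 -> fine_simplex (C a) ((1 - n.+1%:R^-1) ^+ m * D) t ->
     phi t = psi t) ->
  hemisphere k (iter m subdivide phi) = hemisphere k (iter m subdivide psi).
Proof.
move=> kn E; apply: eq_hemisphere => s Es [a Ha].
apply: (@eq_iter_subdivide n.+1 k.+1 m (C a) D) => //; first exact: E.
have Cs : {in s, forall v, C a v}.
  by move=> v /Ha[j jk ->]; apply: C_vertex; exact: leq_trans jk kn.
by split=> // u v /Cs us /Cs vs; apply: (C_diam (a := a)); rewrite inE.
Qed.

(** Stokes: the product is the coboundary of [cup_head f fs], so its value is that of
    [cup_head f fs] on the boundary sphere. Antipodality turns this into the product without [f] on
    the next lower hemisphere. *)
Lemma hemisphere_cup fs : (size fs <= n)%N ->
  {in fs, forall f : V -> bool, forall a v, C a v -> f (- v) = ~~ f v} ->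
  hemisphere (size fs) (iter m subdivide (cup_coboundary fs)).
Proof.
elim: fs => [|f fs IH] nfs anti.
  (* The empty product is 1, and a vertex subdivides to itself. *)
  rewrite /= (_ : iter m _ _ [:: e 0] = true)//.
  elim: m (e 0) => // m' IHm v; rewrite /= /subdivide /= addbF.
  by rewrite /barycenter invr1 scale1r big_seq1 IHm.
rewrite (@eq_hemisphere_subdivide _ _ (coboundary (cup_head f fs)))//; last first.
  by move=> a t Et _; rewrite coboundary_cup_head.
rewrite iter_subdivide_coboundary hemisphere_coboundary iter_subdivideN.
rewrite -hemisphereD -iter_subdivideD.
rewrite (@eq_hemisphere_subdivide _ _ (cup_coboundary fs)) ?(ltnW nfs)//.
  apply: IH; first exact: ltnW.
  by move=> g gfs; apply: anti; rewrite inE gfs orbT.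
move=> a t Et [Ct _]; rewrite cup_head_map// => g gfs v vt.
by apply: (anti _ gfs a); exact: Ct.
Qed.

Lemma fine_cup_simplex fs : size fs = n ->
  {in fs, forall f : V -> bool, forall a v, C a v -> f (- v) = ~~ f v} ->
  exists a t, [/\ size t = n.+1, fine_simplex (C a) ((1 - n.+1%:R^-1) ^+ m * D) t &
    cup_coboundary fs t].
Proof.
move=> nfs anti; apply: contrapT => no.
have := @hemisphere_cup fs; rewrite nfs => /(_ (leqnn _) anti).
rewrite (@eq_hemisphere_subdivide _ _ (fun=> false)) ?leqnn//.
  (* Writing 0 as 0 + 0, linearity gives the value twice, which is 0 mod 2. *)
  rewrite [X in iter m _ X](_ : _ = cochain_add (fun=> false) (fun=> false))//.
  by rewrite iter_subdivideD hemisphereD addbb.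
move=> a t Et Ft; apply/negbTE/negP => cup; apply: no.
by exists a, t.
Qed.

End FineSimplex.
End Subdivision.

(** * The Borsuk-Ulam theorem *)

Section BorsukUlam.
Context {R : realType}.

Lemma rV_norm_le n (v : 'rV[R]_n) (r : R) : 0 <= r ->
  (forall i, `|v 0 i| <= r) -> `|v| <= r.
Proof.
move=> r0 h; rewrite -[leLHS]/(mx_norm v) mx_normrE; apply/bigmax_leP; split=> //.
by move=> [i j] _ /=; rewrite ord1.
Qed.

(** The boundary of the cross-polytope. *)
Definition l1_sphere n : set 'rV[R]_n := [set v | \sum_i `|v 0 i| = 1].

Lemma l1_sphere_coord n (v : 'rV[R]_n) i : l1_sphere v -> `|v 0 i| <= 1.
Proof.
by move=> <-; rewrite (bigD1 i)//= lerDl sumr_ge0.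
Qed.

Lemma l1_sphere_neq0 n (v : 'rV[R]_n) : l1_sphere v -> v != 0.
Proof.
move=> Kv; apply/eqP => v0; move: Kv; rewrite /l1_sphere /= v0 big1.
  by move/esym/eqP; rewrite oner_eq0.
by move=> i _; rewrite mxE normr0.
Qed.

Lemma l1_sphere_opp n (v : 'rV[R]_n) : l1_sphere v -> l1_sphere (- v).
Proof.
by rewrite /l1_sphere /= => <-; apply: eq_bigr => i _; rewrite mxE normrN.
Qed.

Lemma l1_sphere_compact n : compact (@l1_sphere n).
Proof.
apply: bounded_closed_compact.
  exists 1; split=> // x x1 v Kv; apply: (le_trans _ (ltW x1)).
  by apply: rV_norm_le => // i; exact: l1_sphere_coord.
apply: (@closed_comp _ _ (fun v : 'rV[R]_n => \sum_i `|v 0 i|) [set 1]).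
  move=> v _; apply: (continuous_big (@add_continuous _)) => i _ {}v.
  apply: (@continuous_comp _ _ _ (fun w : 'rV[R]_n => w 0 i) Num.norm).
    exact: coord_continuous.
  exact: norm_continuous.
exact: closed_eq.
Qed.

(** The closed facet of the cross-polytope in the orthant with signs [a]. *)
Definition orthant n (a : nat -> bool) : set 'rV[R]_n :=
  [set v | (forall i : 'I_n, 0 <= (-1) ^+ a i * v 0 i) /\
           \sum_(i < n) (-1) ^+ a i * v 0 i = 1].

Lemma orthant_l1_sphere n a (v : 'rV[R]_n) : orthant a v -> l1_sphere v.
Proof.
move=> [v0 v1]; rewrite /l1_sphere /= -v1; apply: eq_bigr => i _.
by rewrite -(ger0_norm (v0 i)) normrM normrX normrN1 expr1n mul1r.
Qed.

Lemma orthant_closed n a : barycenter_closed (orthant (n := n) a).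
Proof.
move=> s s0 Cs; have sz : 0 < (size s)%:R :> R by rewrite ltr0n lt0n size_eq0.
have E (i : 'I_n) : (-1) ^+ a i * (barycenter s) 0 i =
    (size s)%:R^-1 * \sum_(v <- s) (-1) ^+ a i * v 0 i.
  by rewrite mxE summxE mulrCA mulr_sumr.
split=> [i|].
  rewrite E mulr_ge0 ?invr_ge0 ?ler0n// big_seq sumr_ge0// => v /Cs[v0 _].
  exact: v0.
rewrite (eq_bigr _ (fun i _ => E i)) -mulr_sumr exchange_big /= big_seq.
rewrite (eq_bigr (fun=> 1)) => [|v /Cs[]//].
by rewrite -big_seq big_const_seq count_predT iter_addr_0 mulVf// gt_eqF.
Qed.

Lemma orthant_vertex n a j : (j <= n)%N ->
  orthant (n := n.+1) a ((-1) ^+ a j *: delta_mx 0 (inord j)).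
Proof.
move=> jn.
have E (i : 'I_n.+1) :
    (-1) ^+ a i * ((-1) ^+ a j *: delta_mx 0 (inord j) : 'rV[R]_n.+1) 0 i =
    (i == inord j)%:R.
  rewrite !mxE eqxx /=; case: eqP => [->|_]; last by rewrite !mulr0.
  by rewrite inordK ?ltnS// mulr1 -expr2 sqrr_sign.
split=> [i|]; first by rewrite E ler0n.
rewrite (bigD1 (inord j))//= E eqxx big1 ?addr0// => i ij.
by rewrite E (negbTE ij).
Qed.

Lemma orthant_diam n a :
  {in orthant (n := n) a &, forall u v, `|u - v| <= 2}.
Proof.
move=> u v /set_mem/orthant_l1_sphere Ku /set_mem/orthant_l1_sphere Kv.
apply: rV_norm_le => // i; rewrite !mxE (le_trans (ler_normB _ _))//.
by rewrite -[2]/(1 + 1) lerD// l1_sphere_coord.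
Qed.

(** [xget] depends only on the set, so [v] and [- v] share one representative. This gives an
    antipodal colouring away from 0 with no regard to continuity. *)
Definition antipodal_choice n (v : 'rV[R]_n) : bool :=
  v == xget 0 [set v; - v].

Lemma antipodal_choiceN n (v : 'rV[R]_n) : v != 0 ->
  antipodal_choice (- v) = ~~ antipodal_choice v.
Proof.
move=> v0; rewrite /antipodal_choice.
have vN : (v == - v) = false.
  by apply/negbTE; rewrite -addr_eq0 -mulr2n -scaler_nat scaler_eq0 pnatr_eq0.
have -> : [set - v; - - v] = [set v; - v] by rewrite opprK setUC.
case: (@xgetPex _ 0 [set v; - v]) => [|->|->]; first by exists v; left.
- by rewrite eqxx eq_sym vN.
- by rewrite eqxx vN.
Qed.

Definition normalize n (v : 'rV[R]_n) := (Num.sqrt (\sum_i v 0 i ^+ 2))^-1 *: v.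

Lemma sqr_norm_gt0 n (v : 'rV[R]_n) : v != 0 -> 0 < \sum_i v 0 i ^+ 2.
Proof.
move=> v0; rewrite lt_neqAle sumr_ge0 ?andbT => [|i _]; last exact: sqr_ge0.
apply: contra v0; rewrite eq_sym psumr_eq0 => [/allP h|i _]; last exact: sqr_ge0.
apply/eqP/rowP => i; rewrite mxE; apply/eqP.
by have := h i (mem_index_enum _); rewrite sqrf_eq0.
Qed.

Lemma normalize_sphere n (v : 'rV[R]_n.+1) : v != 0 ->
  unit_sphere R n (normalize v).
Proof.
move=> /sqr_norm_gt0 v0; rewrite /unit_sphere /=.
under eq_bigr do rewrite mxE exprMn.
by rewrite -mulr_sumr exprVn sqr_sqrtr ?mulVf ?gt_eqF// ltW.
Qed.

Lemma normalizeN n (v : 'rV[R]_n) : normalize (- v) = - normalize v.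
Proof.
rewrite /normalize scalerN; congr (- ((Num.sqrt _)^-1 *: _)).
by apply: eq_bigr => i _; rewrite mxE sqrrN.
Qed.

Lemma sum_sqr_continuous n : continuous (fun w : 'rV[R]_n => \sum_i w 0 i ^+ 2).
Proof.
apply: (continuous_big (@add_continuous _)) => i _ w.
apply: (@continuous_comp _ _ _ (fun w : 'rV[R]_n => w 0 i) (fun x => x ^+ 2)).
  exact: coord_continuous.
exact: exprn_continuous.
Qed.

Lemma normalize_continuous n (v : 'rV[R]_n) : v != 0 ->
  {for v, continuous (@normalize n)}.
Proof.
move=> v0; have sqrt_cont :=
  continuous_comp (@sum_sqr_continuous n v) (@sqrt_continuous R _).
have sqrt0 : Num.sqrt (\sum_i v 0 i ^+ 2) != 0.
  by rewrite gt_eqF// sqrtr_gt0 sqr_norm_gt0.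
exact: (@cvgZ _ _ _ (nbhs v) _ _ _ _ _ (cvgV sqrt0 sqrt_cont) cvg_id).
Qed.

Lemma l1_borsuk_ulam n m (h : 'rV[R]_n.+1 -> 'I_m -> R) : (m <= n)%N ->
  (forall i, {within @l1_sphere n.+1, continuous (fun v => h v i)}) ->
  (forall v i, l1_sphere v -> h (- v) i = - h v i) ->
  exists2 v, l1_sphere v & forall i, h v i = 0.
Proof.
move=> mn ch hN; apply: contrapT => no.
have {}no v : l1_sphere v -> exists i, h v i != 0.
  move=> Kv; apply: contrapT => nov; apply: no; exists v => // i.
  by apply: contrapT => hv; apply: nov; exists i; exact/eqP.
pose r : R := 1 - n.+1%:R^-1.
have r0 : 0 <= r by rewrite subr_ge0 invf_le1 ?ltr0n// ler1n.
have r1 : `|r| < 1 by rewrite ger0_norm// gtrBl invr_gt0 ltr0n.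
(* Compactness gives a single [k] such that near every point, within [r ^+ k * 2], some coordinate
   has constant nonzero sign. That is the mesh after [k] subdivisions, facets having diameter at
   most 2. *)
have /compact_near_coveringP/(_ _ \oo (fun k x => l1_sphere x -> exists i b,
  forall y, l1_sphere y -> `|x - y| <= r ^+ k * 2 ->
     h y i != 0 /\ (0 < h y i) = b)) := @l1_sphere_compact n.+1.
case=> [x Kx|k _ /(_ k (leqnn k)) Pk].
  have [i hxi] := no x Kx.
  have /subspace_continuousP/(_ x Kx)/cvgr_dist_lt/(_ `|h x i|) := ch i.
  rewrite normr_gt0 => /(_ hxi)/nbhs_ballP[rho /= rho0 rhoP].
  have rho2 : 0 < rho / 2 by rewrite divr_gt0.
  have := cvg_expr r1.
  move=> /cvgr_dist_lt/(_ (rho / 4)).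
  rewrite divr_gt0// => /(_ isT) rk.
  (* With [r ^+ k < rho / 4], the distance [r ^+ k * 2] from [x'] adds less than [rho / 2]. *)
  exists (ball x (rho / 2), [set k | `|0 - r ^+ k| < rho / 4]).
    by split => //=; exact: nbhsx_ballx.
  move=> [x' k] /= [xx' rkk] Kx'.
  exists i, (0 < h x i) => y Ky x'y.
  have : ball x rho y.
    move: xx' rkk; rewrite -!ball_normE /= => xx'.
    rewrite sub0r normrN ger0_norm ?exprn_ge0// => rkk.
    rewrite -(subrKA x') (le_lt_trans (ler_normD _ _))//; lra.
  move=> /rhoP/(_ Ky) hy; have {}hy : `|h x i - h y i| < `|h x i| by exact: hy.
  have [hx|hx|hx] := ltrgt0P (h x i); last by rewrite hx eqxx in hxi.
  - have : 0 < h y i by move: hy; rewrite (gtr0_norm hx) ltr_norml => /andP[? ?]; lra.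
    by move=> hy0; rewrite hy0 gt_eqF.
  - have : h y i < 0 by move: hy; rewrite (ltr0_norm hx) ltr_norml => /andP[? ?]; lra.
    by move=> hy0; rewrite lt_eqF//; split=> //; apply/negbTE; rewrite -leNgt ltW.
(* Where the coordinate vanishes its sign is not antipodal, so an arbitrary choice replaces it. *)
pose colour i v := if h v i != 0 then 0 < h v i else antipodal_choice v.
(* Padding to exactly [n] colourings covers the case [m < n]. *)
pose fs := [seq colour i | i <- enum 'I_m] ++ nseq (n - m) (@antipodal_choice n.+1).
have sfs : size fs = n.
  by rewrite size_cat size_map size_enum_ord size_nseq subnKC.
have colourN i v : l1_sphere v -> colour i (- v) = ~~ colour i v.
  move=> Kv; rewrite /colour hN// oppr_eq0.
  case: eqVneq => [_|hv] /=; first by rewrite antipodal_choiceN// l1_sphere_neq0.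
  by rewrite oppr_gt0 -leNgt lt_neqAle hv.
have anti : {in fs, forall f : 'rV[R]_n.+1 -> bool,
    forall a v, orthant a v -> f (- v) = ~~ f v}.
  move=> f; rewrite mem_cat.
  move=> /orP[/mapP[i _ ->]|/nseqP[-> _]] a v /orthant_l1_sphere Kv.
    exact: colourN.
  by rewrite antipodal_choiceN// l1_sphere_neq0.
have [a [t [st [Ct Dt] cup]]] :=
  @fine_cup_simplex _ _ (fun j => delta_mx 0 (inord j)) n k 2 _ (@orthant_closed _)
    (@orthant_vertex n) (@orthant_diam _) fs sfs anti.
have t0 : head 0 t \in t by case: t st {Ct Dt cup} => //= x t _; exact: mem_head.
have K0 := orthant_l1_sphere (Ct _ t0).
have [i [b ib]] := Pk _ K0 K0.
have cfs : colour i \in fs by rewrite mem_cat map_f// mem_enum.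
have [u [v [ut vt]]] := cup_coboundary_neq (etrans st (congr1 S (esym sfs))) cup cfs.
have colb w : w \in t -> colour i w = b.
  move=> wt; rewrite /colour.
  have [||-> ->//] := ib w _ _; first exact: orthant_l1_sphere (Ct _ wt).
  exact: Dt.
by rewrite !colb// eqxx.
Qed.

Lemma borsuk_ulam n m (g : 'rV[R]_n.+1 -> 'rV[R]_m) : (m <= n)%N ->
  {within unit_sphere R n, continuous g} ->
  exists2 v, unit_sphere R n v & g v = g (- v).
Proof.
move=> mn cg.
(* The odd part of [g], up to a factor, pulled back to the cross-polytope by radial projection. *)
pose h (v : 'rV[R]_n.+1) i := g (normalize v) 0 i - g (normalize (- v)) 0 i.
have cn i : {within @l1_sphere n.+1, continuous (fun v => g (normalize v) 0 i)}.
  apply/subspace_continuousP => v Kv.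
  have v0 := l1_sphere_neq0 Kv.
  move/subspace_continuousP : cg => /(_ _ (normalize_sphere v0)) cg.
  apply: (@cvg_comp _ _ _ (@normalize n.+1) (fun w => g w 0 i) _
    (within (unit_sphere R n) (nbhs (normalize v)))).
    move=> P nP; change (\forall w \near v, l1_sphere w -> P (normalize w)).
    apply: (@filterS _ (nbhs v) _ _ _ _ (normalize_continuous v0 nP)) => w Pw Kw.
    apply: Pw.
    exact/normalize_sphere/l1_sphere_neq0.
  apply: (@cvg_comp _ _ _ g (fun u => u 0 i) _ _ _ cg); exact: coord_continuous.
have [||v Kv hv] := @l1_borsuk_ulam n m h mn.
- move=> i; apply/subspace_continuousP => v Kv; apply: cvgB.
    by move/subspace_continuousP : (cn i); exact.
  move/subspace_continuousP : (cn i) => /(_ _ (l1_sphere_opp Kv)).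
  apply: (@cvg_comp _ _ _ -%R (fun w => g (normalize w) 0 i)) => P nP.
  change (\forall w \near v, l1_sphere w -> P (- w)).
  have {}nP : \forall w \near - v, l1_sphere w -> P w by exact: nP.
  apply: (@filterS _ (nbhs v) _ _ _ _ (@opp_continuous _ v _ nP)) => w Pw.
  by move/l1_sphere_opp; exact: Pw.
- by move=> v i _; rewrite /h opprK opprB.
exists (normalize v); first exact/normalize_sphere/l1_sphere_neq0.
apply/rowP => i; apply/eqP; rewrite -subr_eq0 -normalizeN; apply/eqP; exact: hv.
Qed.

End BorsukUlam.

(** * Convex problems and reductions *)

Section FiniteProbability.
Context {R : realType} {d : measure_display} {T : measurableType d} {I : finType}.
Variables (pt : I -> T) (p : I -> R).
Hypotheses (p_ge0 : forall i, 0 <= p i) (p_sum : \sum_i p i = 1).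

(** [msum] expects a sequence of measures, so the points are enumerated; indices from [#|I|] on get
    the zero measure. *)
Definition atom (k : nat) : {measure set T -> \bar R} :=
  if insub k is Some j then
    mscale (NngNum (p_ge0 (enum_val (j : 'I_#|I|)))) (\d_(pt (enum_val j)))
  else mzero.

(** The proof that the weights add up to 1 is an argument, so that the probability structure can be
    attached to the term. *)
Definition finite_probability of \sum_i p i = 1 : set T -> \bar R :=
  msum atom #|I|.

HB.instance Definition _ := Measure.on (finite_probability p_sum).

Lemma finite_probability_sum (F : {measure set T -> \bar R} -> \bar R) :
  (\sum_(k < #|I|) F (atom k) =
   \sum_i F (mscale (NngNum (p_ge0 i)) (\d_(pt i))))%E.
Proof.
rewrite (reindex (enum_rank : I -> 'I_#|I|)).
  by apply: eq_bigr => i _; rewrite /atom valK enum_rankK.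
by exists enum_val => i _; [exact: enum_rankK|exact: enum_valK].
Qed.

Lemma finite_probabilityE A :
  finite_probability p_sum A = (\sum_i p i * \1_A (pt i))%:E.
Proof.
rewrite /finite_probability /msum (finite_probability_sum (fun m => m A)) -sumEFin.
by apply: eq_bigr => i _; rewrite /= /mscale /= diracE indicE EFinM.
Qed.

Lemma finite_probability_setT : finite_probability p_sum setT = 1%E.
Proof.
rewrite finite_probabilityE -p_sum; congr EFin; apply: eq_bigr => i _.
by rewrite indicT mulr1.
Qed.

HB.instance Definition _ := Measure_isProbability.Build _ _ _
  (finite_probability p_sum) finite_probability_setT.

Lemma integral_finite_probability (f : T -> R) : measurable_fun setT f ->
  (forall x, 0 <= f x) ->
  (\int[finite_probability p_sum]_x (f x)%:E)%E = (\sum_i p i * f (pt i))%:E.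
Proof.
move=> /measurable_EFinP mf f0.
rewrite ge0_integral_measure_sum//; last by move=> x _; rewrite lee_fin.
rewrite (finite_probability_sum (fun m => \int[m]_x (f x)%:E)%E) -sumEFin.
apply: eq_bigr => i _; rewrite ge0_integral_mscale//; last first.
  by move=> x _; rewrite lee_fin.
by rewrite integral_dirac// diracT mul1e EFinM.
Qed.

End FiniteProbability.

(** * Continuous selections from convex-valued maps on the sphere *)

Section Selection.
Context {R : realType}.

Lemma convex_setP (M : lmodType R) (A : set M) : convex_set A ->
  forall (t : R) x y, 0 <= t -> t <= 1 -> A x -> A y -> A (t *: x + (1 - t) *: y).
Proof.
move=> cA t x y t0 t1 Ax Ay.
by have /set_mem := cA x y (Itv01 t0 t1) (mem_set Ax) (mem_set Ay).
Qed.

Lemma convex_functionP (M : lmodType R) (A : set M) (f : M -> R) :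
  convex_function A f -> forall (t : R) x y, 0 <= t -> t <= 1 -> A x -> A y ->
  f (t *: x + (1 - t) *: y) <= t * f x + (1 - t) * f y.
Proof.
move=> cf t x y t0 t1 Ax Ay.
exact: (cf (Itv01 t0 t1) x y (mem_set Ax) (mem_set Ay)).
Qed.

(** Membership is asked only at positive weights, since in a partition of unity a local selection is
    valid only where its bump is positive. *)
Lemma convex_weighted_mean (M : lmodType R) (A : set M) (I : eqType) (s : seq I)
    (l : I -> R) (w : I -> M) :
  (forall (t : R) x y, 0 <= t -> t <= 1 -> A x -> A y -> A (t *: x + (1 - t) *: y)) ->
  (forall i, 0 <= l i) -> {in s, forall i, 0 < l i -> A (w i)} ->
  0 < \sum_(i <- s) l i ->
  A ((\sum_(i <- s) l i)^-1 *: \sum_(i <- s) l i *: w i).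
Proof.
move=> cA l0; elim: s => [|i s IH] As; first by rewrite big_nil ltxx.
have {}IH : 0 < \sum_(i <- s) l i ->
    A ((\sum_(i <- s) l i)^-1 *: \sum_(i <- s) l i *: w i).
  by apply: IH => j js; apply: As; rewrite inE js orbT.
rewrite !big_cons; set L := \sum_(j <- s) l j in IH *.
set W := \sum_(j <- s) _ in IH *.
have L0 : 0 <= L by exact: sumr_ge0.
have [li|li|li] := ltrgt0P (l i); last 2 first.
- by move: (l0 i); rewrite leNgt li.
- by rewrite li add0r scale0r add0r.
have Ai : A (w i) by apply: As; rewrite ?mem_head.
move: L0; rewrite le_eqVlt => /predU1P[L0 _|Lgt0 sgt0].
  have -> : W = 0.
    move: (esym L0) => /eqP; rewrite psumr_eq0// => /allP ls.
    rewrite /W big_seq big1// => j js.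
    by rewrite (eqP (ls j js)) scale0r.
  by rewrite -L0 !addr0 scalerA mulVf ?gt_eqF// scale1r.
have -> : (l i + L)^-1 *: (l i *: w i + W) =
    (l i / (l i + L)) *: w i + (1 - l i / (l i + L)) *: (L^-1 *: W).
  rewrite scalerDr !scalerA; congr (_ *: _ + _ *: _); first by rewrite mulrC.
  by field; rewrite !gt_eqF.
apply: cA => //; last exact: IH.
  by rewrite divr_ge0// ltW.
by rewrite ler_pdivrMr// mul1r lerDl ltW.
Qed.

Lemma unit_sphere_compact n : compact (unit_sphere R n).
Proof.
apply: bounded_closed_compact.
  exists 1; split=> // x x1 v Sv; apply: (le_trans _ (ltW x1)).
  apply: rV_norm_le => // i; rewrite -(@expr_le1 _ 2)// -normrX ger0_norm ?sqr_ge0//.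
  by rewrite -Sv (bigD1 i)//= lerDl sumr_ge0// => j _; exact: sqr_ge0.
apply: (@closed_comp _ _ (fun v : 'rV[R]_n.+1 => \sum_i v 0 i ^+ 2) [set 1]).
  by move=> v _; exact: sum_sqr_continuous.
exact: closed_eq.
Qed.

Lemma unit_sphere_opp n (v : 'rV[R]_n.+1) :
  unit_sphere R n v -> unit_sphere R n (- v).
Proof.
by rewrite /unit_sphere /= => <-; apply: eq_bigr => i _; rewrite mxE sqrrN.
Qed.

(* Glues locally constant selections of a convex-valued map by a partition of
   unity. *)
Lemma continuous_selection n m (A : 'rV[R]_n.+1 -> set 'rV[R]_m) :
  (forall u, unit_sphere R n u ->
     forall (t : R) x y, 0 <= t -> t <= 1 -> A u x -> A u y ->
     A u (t *: x + (1 - t) *: y)) ->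
  (forall u, unit_sphere R n u -> exists w,
     \forall u' \near u, unit_sphere R n u' -> A u' w) ->
  exists2 w : 'rV[R]_n.+1 -> 'rV[R]_m,
    {within unit_sphere R n, continuous w} &
    forall u, unit_sphere R n u -> A u (w u).
Proof.
move=> cA locA.
have /choice[rw rwP] : forall u, exists rw : R * 'rV[R]_m, unit_sphere R n u ->
    0 < rw.1 /\ forall u', ball u rw.1 u' -> unit_sphere R n u' -> A u' rw.2.
  move=> u; have [Su|nSu] := pselect (unit_sphere R n u); last by exists (0, 0).
  have [w /nbhs_ballP[r /= r0 rP]] := locA u Su.
  by exists (r, w) => _; split=> // u' /rP.
have := @unit_sphere_compact n; rewrite compact_cover.
move=> /(_ _ (unit_sphere R n) (fun u => ball u (rw u).1)) [||D DS cover].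
- by move=> u Su; exact: ball_open.
- by move=> u Su; exists u => //; apply: ballxx; case: (rwP u Su).
(* [l x] is twice the positive part of [a x]: a continuous bump, positive exactly on the ball around
   [x]. *)
pose a x u := (rw x).1 - `|x - u|; pose l x u := a x u + `|a x u|.
have l0 x u : 0 <= l x u by rewrite -lerBlDl sub0r -normrN ler_norm.
have lE x u : (0 < l x u) = (`|x - u| < (rw x).1).
  rewrite -[RHS]subr_gt0 -/(a x u) /l; have [a0|a0] := ltrP 0 (a x u).
    by rewrite gtr0_norm// addr_gt0.
  by rewrite ler0_norm// subrr ltxx.
have lsum u : unit_sphere R n u -> 0 < \sum_(x <- D) l x u.
  move=> Su; have [x xD xu] := cover u Su.
  rewrite (big_rem x)//= ltr_wpDr ?sumr_ge0// lE.
  by move: xu; rewrite -ball_normE.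
have lcont x : continuous (l x).
  move=> u; have ca : a x v @[v --> nbhs u] --> a x u.
    apply: (@cvgB _ _ _ (nbhs u)); first exact: cvg_cst.
    apply: (@cvg_norm _ _ _ (nbhs u)); apply: (@cvgB _ _ _ (nbhs u)).
      exact: cvg_cst.
    exact: cvg_id.
  by apply: (@cvgD _ _ _ (nbhs u)); last exact: cvg_norm.
exists (fun u => (\sum_(x <- D) l x u)^-1 *: \sum_(x <- D) l x u *: (rw x).2).
  apply/subspace_continuousP => u Su; apply: cvg_within_filter.
  have sum_cont : (\sum_(x <- D) l x v @[v --> nbhs u] --> \sum_(x <- D) l x u).
    by apply: (continuous_big (@add_continuous _)) => x _; exact: lcont.
  have sum0 : \sum_(x <- D) l x u != 0 by rewrite gt_eqF// lsum.
  apply: (@cvgZ _ _ _ (nbhs u) _ _ _ _ _ (cvgV sum0 sum_cont)).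
  apply: (continuous_big (@add_continuous _)) => x _ v.
  exact: (@cvgZ _ _ _ (nbhs v) _ _ _ _ _ (lcont x v) (cvg_cst _)).
move=> u Su; apply: convex_weighted_mean (lsum u Su) => //; first exact: cA.
move=> x xD; rewrite lE => xu.
by have [_] := rwP x (set_mem (DS x xD)); apply; rewrite // -ball_normE.
Qed.

End Selection.

(** * Near-minimizers of the risk for finitely supported distributions *)

Section NearMinimizers.
Context {R : realType} {V : finType} {M : lmodType R}.
Variables (W : set M) (loss : V -> M -> R) (alpha : R).
Hypotheses (W_convex : convex_set W) (W_nonempty : W !=set0).
Hypothesis loss_convex : forall q, convex_function W (loss q).
Hypothesis loss_ge0 : forall q w, W w -> 0 <= loss q w.
Hypothesis alpha_gt0 : 0 < alpha.

Definition risk (p : V -> R) (w : M) : R := \sum_q p q * loss q w.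

Definition near_min (p : V -> R) : set M :=
  [set w | W w /\ forall w', W w' -> risk p w <= risk p w' + alpha].

Lemma risk_ge0 p w : (forall q, 0 <= p q) -> W w -> 0 <= risk p w.
Proof. by move=> p0 Ww; apply: sumr_ge0 => q _; rewrite mulr_ge0// loss_ge0. Qed.

Lemma near_min_convex p (t : R) x y : (forall q, 0 <= p q) -> 0 <= t -> t <= 1 ->
  near_min p x -> near_min p y -> near_min p (t *: x + (1 - t) *: y).
Proof.
move=> p0 t0 t1 [Wx px] [Wy py].
split=> [|w Ww]; first exact: convex_setP.
have t1' : 0 <= 1 - t by rewrite subr_ge0.
have : risk p (t *: x + (1 - t) *: y) <= t * risk p x + (1 - t) * risk p y.
  rewrite !mulr_sumr -big_split; apply: ler_sum => q _ /=.
  rewrite (mulrCA t) (mulrCA (1 - t)) -mulrDr; apply: ler_wpM2l => //.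
  exact: convex_functionP.
have := ler_wpM2l t0 (px w Ww); have := ler_wpM2l t1' (py w Ww).
rewrite !mulrDr; lra.
Qed.

(* Scaling down [p] by [1 - eps] bounds all nearby distributions from below, so
   the infimal risk is lower semicontinuous because losses are nonnegative. *)
Lemma near_min_locally_constant (p : V -> R) : (forall q, 0 <= p q) ->
  exists w, forall T (F : set_system T) (f : T -> V -> R), Filter F ->
    (forall q, f t q @[t --> F] --> p q) ->
    (\forall t \near F, forall q, 0 <= f t q) ->
    \forall t \near F, near_min (f t) w.
Proof.
move=> p0; pose E := [set risk p w | w in W].
have lbE : lbound E 0 by move=> _ [w Ww <-]; exact: risk_ge0.
have infE : has_inf E.
  by case: W_nonempty => w Ww; split; [exists (risk p w), w|exists 0].
have a3 : 0 < alpha / 3 by rewrite divr_gt0.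
have [_ [w Ww <-] wE] := inf_adherent a3 infE.
have {infE}wmin w' : W w' -> risk p w <= risk p w' + alpha / 3.
  move=> Ww'; have : inf E <= risk p w' by apply: ge_inf; [exists 0|exists w'].
  by move=> ?; lra.
exists w => T F f FF fp f0.
set c := risk p w in wE wmin *.
have c0 : 0 <= c by exact: risk_ge0.
(* Chosen so that scaling by [1 - eps] lowers the value [c + alpha / 3] by exactly [alpha / 3]. *)
pose eps := (alpha / 3) / (c + alpha / 3).
have ca : 0 < c + alpha / 3 by rewrite ltr_wpDl.
have eps0 : 0 < eps by rewrite divr_gt0.
have eps1 : eps <= 1 by rewrite ler_pdivrMr// mul1r lerDr.
have epsc : eps * (c + alpha / 3) = alpha / 3 by rewrite /eps mulfVK// gt_eqF.
(* Where [p q] is 0 this is mere nonnegativity; elsewhere the inequality is strict in the limit. *)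
have lower : \forall t \near F, forall q, (1 - eps) * p q <= f t q.
  apply: filter_forall => q; have := p0 q; rewrite le_eqVlt => /predU1P[<-|pq].
    by apply: filterS f0 => t /(_ q); rewrite mulr0.
  have : (1 - eps) * p q < p q by rewrite gtr_pMl// gtrBl.
  by move=> /(cvgr_gt _ (fp q)); apply: filterS => t /ltW.
have upper : \forall t \near F, risk (f t) w < c + alpha / 3.
  have : risk (f t) w @[t --> F] --> c.
    apply: (cvg_big (@add_continuous _)) => q _.
    by apply: cvgM; [exact: fp|exact: cvg_cst].
  by move=> /cvgr_lt; apply; rewrite ltrDl.
near=> t; split=> // w' Ww'.
have up : risk (f t) w < c + alpha / 3 by near: t.
have : (1 - eps) * risk p w' <= risk (f t) w'.
  rewrite mulr_sumr; apply: ler_sum => q _; rewrite mulrA ler_wpM2r// ?loss_ge0//.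
  by move: q; near: t.
have : (1 - eps) * (c - alpha / 3) <= (1 - eps) * risk p w'.
  by rewrite ler_wpM2l ?subr_ge0// lerBlDr wmin.
(* By the choice of [eps], the lower bound [(1 - eps) * (c - alpha / 3)] equals
   [c - 2 alpha / 3 + 2 eps alpha / 3], which exceeds [(c + alpha / 3) - alpha]. *)
have : 0 < eps * (alpha / 3) by rewrite mulr_gt0.
move: epsc up; rewrite mulrDr !mulrBl !mul1r !mulrBr; lra.
Unshelve. all: by end_near. Qed.

End NearMinimizers.

(** * The guarantee of a reduction on finitely supported distributions *)

Section Reduction.
Context {R : realType} {d dZ : measure_display} {X : measurableType d}.
Context {Z : measurableType dZ} {V : finType} {n : nat}.
Variables (H : set (X -> bool)) (P : sco_problem R n Z) (alpha beta : R).
Variables (rin : X * bool -> Z) (rout : 'rV[R]_n -> X -> bool).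
Hypothesis red : is_reduction H P alpha beta rin rout.
Variables (pt : V -> X * bool) (p : V -> R).
Hypotheses (p_ge0 : forall q, 0 <= p q) (p_sum : \sum_q p q = 1).

Let mu : probability (X * bool)%type R := finite_probability pt p_ge0 p_sum.

Lemma class_loss_finite_probability h : class_loss mu h =
  (\sum_q p q * (h (pt q).1 != (pt q).2)%:R)%:E.
Proof.
rewrite /class_loss /= finite_probabilityE; congr EFin; apply: eq_bigr => q _.
by rewrite indicE mem_setE.
Qed.

(** Since [h] is correct on the support, it has loss 0 and the distribution is realizable; both the
    risk and the loss are then finite sums. *)
Lemma near_min_class_loss h w : H h ->
  (forall q, p q != 0 -> h (pt q).1 = (pt q).2) ->
  near_min (sco_dom P) (fun q => sco_loss P (rin (pt q))) alpha p w ->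
  \sum_q p q * (rout w (pt q).1 != (pt q).2)%:R <= beta.
Proof.
move=> Hh hp [Ww wmin]; case: red => mrin mrout; move=> /(_ mu) hred.
rewrite -lee_fin -class_loss_finite_probability; apply: hred => //.
  apply/eqP; rewrite eq_le; apply/andP; split.
    apply: ereal_inf_lbound; exists h => //.
    rewrite class_loss_finite_probability big1// => q _.
    have [->|/hp ->] := eqVneq (p q) 0; first by rewrite mul0r.
    by rewrite eqxx mulr0.
  apply: le_ereal_inf_tmp => _ [g _ <-]; exact: measure_ge0.
have riskE w' : sco_dom P w' -> sco_risk P (pushforward mu rin) w' =
    (risk (fun q => sco_loss P (rin (pt q))) p w')%:E.
  move=> Ww'; rewrite /sco_risk ge0_integral_pushforward//.
  - rewrite preimage_setT; apply: integral_finite_probability => //.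
      exact: measurableT_comp (sco_loss_measurable Ww') mrin.
    by move=> x /=; exact: sco_loss_ge0.
  - by apply/measurable_EFinP; exact: sco_loss_measurable.
  - by move=> z _; rewrite lee_fin sco_loss_ge0.
rewrite riskE// -leeBlDr// -EFinB; apply: le_ereal_inf_tmp => _ [w' Ww' <-].
by rewrite riskE// lee_fin lerBlDr wmin.
Qed.

End Reduction.

(** * Comparison of the two dimensions *)

Lemma antipodal_sphere_dim_lt (R : realType) d (X : measurableType d)
    (H : set (X -> bool)) (n m : nat) :
  antipodal_sphere_map R H n -> sco_reducible R H m -> (n < m)%N.
Proof.
move=> [X' [f [cf fK fN]]] [dZ [Z [P [alpha [beta [rin [rout [a0 b0 red]]]]]]]].
rewrite ltnNge; apply/negP => mn.
pose V : finType := (X' * bool)%type.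
pose pt (q : V) : X * bool := (val q.1, q.2).
pose A u := near_min (sco_dom P) (fun q : V => sco_loss P (rin (pt q))) alpha (f u).
have fq q u : unit_sphere R n u ->
    f v q @[v --> within (unit_sphere R n) (nbhs u)] --> f u q.
  move=> Su; move/subspace_continuousP : cf => /(_ u Su) cfu.
  apply: (@cvg_comp _ _ _ f (fun g => g q) _ _ _ cfu).
  exact: (@proj_continuous V (fun=> R) q (f u)).
have [u Su|u Su|w cw wA] := @continuous_selection R n m A.
- case: (fK u Su) => p0 _ _ t x y; apply: near_min_convex => //.
    exact: sco_dom_convex.
  by move=> q; exact: sco_loss_convex.
- case: (fK u Su) => p0 _ _.
  have [w wP] := near_min_locally_constant (sco_dom_nonempty P)
    (fun q : V => @sco_loss_ge0 _ _ _ _ P (rin (pt q))) a0 p0.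
  exists w.
  apply: (wP _ (within (unit_sphere R n) (nbhs u))).
  + by move=> q; exact: fq.
  + rewrite near_withinE; near=> v => Sv q.
    by case: (fK v Sv).
have [u Su wu] := borsuk_ulam mn cw.
have bound v : unit_sphere R n v -> w v = w u ->
    \sum_q f v q * (rout (w u) (pt q).1 != (pt q).2)%:R <= beta.
  move=> Sv <-; case: (fK v Sv) => p0 p1 [[_ [h Hh <-] hv] _].
  apply: (near_min_class_loss red p0 p1 Hh _ (wA v Sv)) => q qv.
  exact: hv.
have := bound u Su erefl.
have := bound _ (unit_sphere_opp Su) (esym wu).
case: (fK u Su) => _ p1 _.
(* Reindexing turns the loss on [f (- u)] into a sum with the weights [f u] and negated labels. *)
rewrite (reindex_inj (h := flip)); last first.
  by apply: (can_inj (g := flip)) => -[x y]; rewrite /flip negbK.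
rewrite fN// => b1 b2.
(* At each vertex the output errs on exactly one of the two labels, so the two losses together carry
   the full weight 1, against [beta < 1 / 2]. *)
have : \sum_q f u q <= beta + beta.
  apply: le_trans (lerD b1 b2); rewrite -big_split; apply: ler_sum => -[x y] _ /=.
  rewrite /flip /= negbK -mulrDr.
  by case: (rout _ _); case: y; rewrite /= ?addr0 ?add0r mulr1.
rewrite p1; move: b0 => /andP[]; lra.
Unshelve. all: by end_near. Qed.

Theorem theorem4p7 (R : realType) (d : measure_display) (X : measurableType d)
    (H : set (X -> bool)) (hH : class_of H) :
  (sd R H + 1 <= SCO R H)%E.
Proof.
apply: le_ereal_inf_tmp => _ [m redm <-].
(* The default value -1 only requires [0 <= m]. *)
rewrite -leeBrDr//; apply: ge_ereal_sup => _ [->|[n mapn <-]].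
  by rewrite -EFinB lee_fin lerBrDr addNr.
rewrite -EFinB lee_fin lerBrDr natr1 ler_nat.
exact: antipodal_sphere_dim_lt mapn redm.
Qed.
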